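(* Let $r\ge 1$, let $a_1,\dots,a_r,b_1,\dots,b_r$ be positive integers, let $q\in\mathbb{C}$ with $|q|<1$, and let $y\in\mathbb{C}$. Then for all $n\ge 0$, $$\int_x^{x+y}E_{n,q}(u\mid a_1,\dots,a_r;b_1,\dots,b_r)\,du=\frac{e^{yt}-1}{t}\,E_{n,q}(x\mid a_1,\dots,a_r;b_1,\dots,b_r),$$ where on the right-hand side the formal power series $\frac{e^{yt}-1}{t}$ acts on polynomials in $x$ as a differential operator.
   Context: The multivariate $q$-Euler polynomials $E_{n,q}(x\mid a_1,\dots,a_r;b_1,\dots,b_r)$ are defined by the generating function $$\sum_{n=0}^{\infty}E_{n,q}(x\mid a_1,\dots,a_r;b_1,\dots,b_r)\frac{t^n}{n!}=\frac{2^r}{(q^{b_1}e^{a_1t}+1)\cdots(q^{b_r}e^{a_rt}+1)}e^{xt}.$$ A formal power series $f(t)=\sum_{k\ge0}c_k\frac{t^k}{k!}$ with $c_k\in\mathbb{C}$ acts on a polynomial $p(x)\in\mathbb{C}[x]$ as an operator through $t^kp(x)=p^{(k)}(x)=\frac{d^kp(x)}{dx^k}$, i.e. $f(t)p(x)=\sum_{k\ge0}\frac{c_k}{k!}p^{(k)}(x)$ (a finite sum). Here $\frac{e^{yt}-1}{t}$ denotes the formal power series $\sum_{j\ge1}\frac{y^j}{j!}t^{j-1}$. The integral of a polynomial between complex limits is the difference of the values of a polynomial antiderivative. *)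

(* Defs.v *)
From HB Require Import structures.
From mathcomp Require Import all_boot all_order all_algebra.
From mathcomp Require Import boolp reals complex.

Set Implicit Arguments.
Unset Strict Implicit.
Unset Printing Implicit Defensive.

Import Order.TTheory GRing.Theory Num.Theory.
Local Open Scope ring_scope.

(* Formal power series \sum_k (f k) t^k; f k is the ordinary coefficient,     *)
(* not the exponential one.                                                   *)
Record fps (A : Type) := Fps { fps_coef :> nat -> A }.

Lemma fpsP (A : Type) (f g : fps A) : (forall n, f n = g n) -> f = g.
Proof. by case: f g => [f] [g] /= fg; congr Fps; apply/funext. Qed.

HB.instance Definition _ (A : Type) := gen_eqMixin (fps A).
HB.instance Definition _ (A : Type) := gen_choiceMixin (fps A).

Section FpsRing.
Variable A : comUnitRingType.
Implicit Types f g h : fps A.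

Definition fps_const (c : A) : fps A := Fps (fun n => if n == 0%N then c else 0).
Definition fps_add f g : fps A := Fps (fun n => f n + g n).
Definition fps_opp f : fps A := Fps (fun n => - f n).
Definition fps_mul f g : fps A := Fps (fun n => \sum_(i < n.+1) f i * g (n - i)%N).

Fact fps_addA : associative fps_add.
Proof. by move=> f g h; apply: fpsP => n /=; rewrite addrA. Qed.
Fact fps_addC : commutative fps_add.
Proof. by move=> f g; apply: fpsP => n /=; rewrite addrC. Qed.
Fact fps_add0 : left_id (fps_const 0) fps_add.
Proof. by move=> f; apply: fpsP => n /=; rewrite if_same add0r. Qed.
Fact fps_addN : left_inverse (fps_const 0) fps_opp fps_add.
Proof. by move=> f; apply: fpsP => n /=; rewrite if_same addNr. Qed.

HB.instance Definition _ :=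
  GRing.isZmodule.Build (fps A) fps_addA fps_addC fps_add0 fps_addN.

Let trunc m f : {poly A} := \poly_(i < m) f i.

Let mul_trunc m f g n : (n < m)%N -> fps_mul f g n = (trunc m f * trunc m g)`_n.
Proof.
move=> nm; rewrite coefM /=; apply: eq_bigr => i _.
rewrite !coef_poly (leq_ltn_trans (leq_subr _ _) nm).
by rewrite (leq_ltn_trans _ nm) // -ltnS.
Qed.

Fact fps_mulA : associative fps_mul.
Proof.
move=> f g h; apply: fpsP => n.
transitivity ((trunc n.+1 f * (trunc n.+1 g * trunc n.+1 h))`_n).
  rewrite coefM; apply: eq_bigr => i _; rewrite coef_poly ltn_ord.
  by rewrite -mul_trunc // ltnS leq_subr.
rewrite mulrA coefM; apply: eq_bigr => i _.
by rewrite coef_poly ltnS leq_subr -mul_trunc.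
Qed.

Fact fps_mulC : commutative fps_mul.
Proof.
by move=> f g; apply: fpsP => n; rewrite !(@mul_trunc n.+1) // mulrC.
Qed.

Fact fps_mul1 : left_id (fps_const 1) fps_mul.
Proof.
move=> f; apply: fpsP => n /=; rewrite big_ord_recl /= mul1r subn0 big1 ?addr0 //.
by move=> i _; rewrite mul0r.
Qed.

Fact fps_mulD : left_distributive fps_mul fps_add.
Proof.
move=> f g h; apply: fpsP => n /=; rewrite -big_split /=.
by apply: eq_bigr => i _; rewrite mulrDl.
Qed.

Fact fps_one_neq0 : fps_const 1 != 0.
Proof.
by apply/eqP => /(congr1 (fun f : fps A => f 0%N)) /= /eqP; rewrite oner_eq0.
Qed.

HB.instance Definition _ := GRing.Zmodule_isComNzRing.Build (fps A)
  fps_mulA fps_mulC fps_mul1 fps_mulD fps_one_neq0.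

Definition fps_unit : pred (fps A) := fun f => f 0%N \is a GRing.unit.

(* The first n+1 coefficients of 1/f, from g_0 = 1/f_0 and                    *)
(* g_{m+1} = - (1/f_0) \sum_(i <= m) f_{i+1} g_{m-i}.                         *)
Fixpoint fps_inv_seq f (n : nat) : seq A :=
  if n is m.+1 then
    let s := fps_inv_seq f m in
    rcons s (- (f 0%N)^-1 * \sum_(i < m.+1) f i.+1 * s`_(m - i))
  else [:: (f 0%N)^-1].

Definition fps_inv f : fps A :=
  if fps_unit f then Fps (fun n => (fps_inv_seq f n)`_n) else f.

Let size_inv_seq f n : size (fps_inv_seq f n) = n.+1.
Proof. by elim: n => //= n IHn; rewrite size_rcons IHn. Qed.

Let nth_inv_seq f n m : (m <= n)%N -> (fps_inv_seq f n)`_m = (fps_inv_seq f m)`_m.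
Proof.
elim: n => [|n IHn]; first by rewrite leqn0 => /eqP ->.
rewrite leq_eqVlt => /predU1P[-> //|mn].
by rewrite /= nth_rcons size_inv_seq mn IHn.
Qed.

Fact fps_mulV : {in fps_unit, left_inverse 1 fps_inv *%R}.
Proof.
move=> f fU; rewrite mulrC; have f0 : f 0%N \is a GRing.unit by [].
rewrite /fps_inv (_ : fps_unit f = true) //; apply: fpsP => -[|n] /=.
  by rewrite big_ord_recl big_ord0 addr0 /= mulrV.
rewrite big_ord_recl subn0 /= nth_rcons size_inv_seq ltnn eqxx.
rewrite mulrA mulrN mulrV // mulN1r.
apply/eqP; rewrite addrC subr_eq0; apply/eqP.
apply: eq_bigr => i _; rewrite /bump /= add1n subSS.
by rewrite [in RHS]nth_inv_seq // leq_subr.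
Qed.

Fact fps_unitPl f g : g * f = 1 -> fps_unit f.
Proof.
move/(congr1 (fun f : fps A => f 0%N)) => /=; rewrite big_ord_recl big_ord0 addr0.
by rewrite subn0 mulrC => fg; apply/unitrPr; exists (g 0%N).
Qed.

Fact fps_inv_out : {in [predC fps_unit], fps_inv =1 id}.
Proof. by move=> f; rewrite inE /= /fps_inv => /negbTE; rewrite -topredE /= => ->. Qed.

HB.instance Definition _ := GRing.ComNzRing_hasMulInverse.Build (fps A)
  fps_mulV fps_unitPl fps_inv_out.

(* e^{ct}; meant for A in which every k! is invertible.                       *)
Definition fps_exp (c : A) : fps A := Fps (fun k => c ^+ k / k`!%:R).

End FpsRing.

(* Action of f(t) on polynomials with t acting as d/dx. The sum stops at      *)
(* size p because p^`(k) = 0 for size p <= k.                                 *)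
Definition fps_act (F : fieldType) (f : fps F) (p : {poly F}) : {poly F} :=
  \sum_(k < size p) f k *: p^`(k).

(* (e^{yt} - 1) / t                                                           *)
Definition fps_expm1_divt (F : fieldType) (y : F) : fps F :=
  Fps (fun k => y ^+ k.+1 / k.+1`!%:R).

Lemma fps_expm1_divtE (F : fieldType) (y : F) :
  Fps (fun k => (k == 1%N)%:R) * fps_expm1_divt y = fps_exp y - 1.
Proof.
apply: fpsP => -[|n]; first by rewrite /= big_ord_recl big_ord0 /= mul0r addr0 expr0 divr1 subrr.
rewrite /= big_ord_recl /= mul0r add0r big_ord_recl /= mul1r subSS subn0.
by rewrite big1 ?subr0 ?oppr0 ?addr0 // => i _; rewrite mul0r.
Qed.

Definition antideriv (F : fieldType) (p : {poly F}) : {poly F} :=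
  \poly_(i < (size p).+1) (if i is j.+1 then p`_j / j.+1%:R else 0).

Definition poly_integral (F : fieldType) (p : {poly F}) (u v : F) : F :=
  (antideriv p).[v] - (antideriv p).[u].

Lemma deriv_antideriv (F : numFieldType) (p : {poly F}) : (antideriv p)^`() = p.
Proof.
apply/polyP => i; rewrite coef_deriv coef_poly ltnS.
case: ltnP => [_|pi]; last by rewrite mul0rn nth_default.
by rewrite /= -[LHS]mulr_natr divfK // pnatr_eq0.
Qed.

Section QEuler.
Variables (F : numFieldType) (r : nat) (q : F) (a b : 'I_r -> nat).

Definition qEuler_den : fps {poly F} :=
  \prod_(i < r) (fps_const (q ^+ b i)%:P * fps_exp (a i)%:R + 1).

(* The generating function, in F[x][[t]].                                     *)
Definition qEuler_gf : fps {poly F} := 2 ^+ r / qEuler_den * fps_exp 'X.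

Definition qEuler (n : nat) : {poly F} := n`!%:R * qEuler_gf n.

Lemma qEuler_egf : Fps (fun n => qEuler n / n`!%:R) = qEuler_gf.
Proof.
apply: fpsP => n; rewrite /= mulrC mulKr //.
by rewrite -polyC_natr poly_unitE size_polyC coefC /= unitfE pnatr_eq0 -lt0n fact_gt0.
Qed.

Lemma qEuler_den_unit : `|q| < 1 -> (forall i, (0 < b i)%N) ->
  qEuler_den \is a GRing.unit.
Proof.
move=> q1 b0; apply: (big_ind (fun f => f \is a GRing.unit)).
- exact: unitr1.
- by move=> f g fU gU; rewrite unitrM fU.
move=> i _; rewrite unfold_in /= /fps_unit /= big_ord_recl big_ord0 addr0 /=.
rewrite expr0 divr1 mulr1 -polyCD.
have qb : q ^+ b i + 1 != 0.
  rewrite addr_eq0; apply: contraTneq (q1) => qb.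
  have : `|q| ^+ b i < 1 by rewrite exprn_ilt1 // -lt0n.
  by rewrite -normrX qb normrN1 ltxx.
by rewrite poly_unitE size_polyC qb coefC /= unitfE.
Qed.

End QEuler.

(* Main.v *)
Require Import Defs.
From HB Require Import structures.
From mathcomp Require Import all_boot all_order all_algebra.
From mathcomp Require Import boolp reals complex.

(** The identity is a form of Taylor's formula, and it holds for every
    polynomial p over a field of characteristic 0. Let P be an antiderivative
    of p. The Taylor expansion of P at x, with its constant term P(x) moved to
    the other side, reads
      P(x + y) - P(x) = sum_(k >= 0) y^(k+1) / (k+1)! * P^(k+1)(x),
    and P^(k+1) = p^(k). The left-hand side is the integral of p from x to
    x + y; the right-hand side is the series of coefficients y^(k+1) / (k+1)!,
    which is (e^(yt) - 1) / t, applied to p and evaluated at x. This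
    is [poly_integral_fps_act], which the theorem applies to the q-Euler
    polynomial. *)

Set Implicit Arguments.
Unset Strict Implicit.
Unset Printing Implicit Defensive.

Import Order.TTheory GRing.Theory Num.Theory.
Local Open Scope ring_scope.

Lemma poly_integral_fps_act (F : numFieldType) (p : {poly F}) (x y : F) :
  poly_integral p x (x + y) = (fps_act (fps_expm1_divt y) p).[x].
Proof.
(* This bound lets the Taylor sum of the antiderivative stop one index after
   the sum that defines the action on p, so that the two match once the
   constant term is split off. *)
have szP : (size (antideriv p) <= (size p).+1)%N by apply: size_poly.
rewrite /poly_integral (nderiv_taylor_wide (mulrC x y) szP).
rewrite big_ord_recl nderivn0 expr0 mulr1 addrC addKr.
rewrite /fps_act horner_sum; apply: eq_bigr => k _.
have -> : p^`(k) = (antideriv p)^`(k.+1) by rewrite derivSn deriv_antideriv.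
rewrite hornerZ nderivn_def hornerMn /= /bump /= add1n.
by rewrite -[_.[x] *+ _]mulr_natl mulrA divfK ?pnatr_eq0 -?lt0n ?fact_gt0 // mulrC.
Qed.

Theorem theorem3 (R : realType) (r : nat) (a b : 'I_r -> nat) (q y : R[i])
    (hr : (0 < r)%N) (ha : forall i, (0 < a i)%N) (hb : forall i, (0 < b i)%N)
    (hq : `|q| < 1) (n : nat) (x : R[i]) :
  poly_integral (qEuler q a b n) x (x + y)
    = (fps_act (fps_expm1_divt y) (qEuler q a b n)).[x].
Proof. exact: poly_integral_fps_act. Qed.
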